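(* Consider the interconnected system $\dot x_i = f_i(x)+g_i(x)u_i$, $i=1,\dots,N$, with safety function $h$, safety set $\mathcal{C}=\{x: h(x)\ge 0\}$, margin $c>0$ and $\mathcal{C}_c=\{x: h(x)\ge c\}$. Consider an attack cycle $[t_0,t_f]$ in which each subsystem is compromised at most once. Assume $x(t_0)\in\mathcal{C}_c$ and that the nominal policy $\hat u=(\hat u_1,\dots,\hat u_N)$ satisfies the nominal-policy assumption stated in the context. Let each subsystem $S_i$ employ the resilient architecture $M(S_i)$, with recovery time $t(M(S_i))$. Let $\rho_1,\dots,\rho_N<0$ be scalars such that for each $i$ $$\frac{\partial h}{\partial x_i}(x)\, g_i(x)\,(u_i-\hat u_i(x))\ \ge\ \rho_i\qquad \text{for all } x\in\mathcal{C}\setminus\mathcal{C}_c \text{ and all } u_i\in\mathcal{U}_i .$$ If $$\sum_{i=1}^N \rho_i\, t(M(S_i)) + c \ \ge\ 0,$$ then the system is safe during the attack cycle, i.e. $x(t)\in\mathcal{C}$ for all $t\in[t_0,t_f]$, for every attack scenario (any order and any temporal overlap of the compromises, and any admissible corrupted inputs).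
   Context: System: there are $N$ subsystems $\mathcal{S}=\{S_1,\dots,S_N\}$ with states $x_i\in\mathbb{R}^{n_i}$, $x=[x_1^T\cdots x_N^T]^T\in\mathbb{R}^n$, $n=\sum_i n_i$, and dynamics $\dot x_i=f_i(x)+g_i(x)u_i$, where $f_i:\mathbb{R}^n\to\mathbb{R}^{n_i}$ and $g_i:\mathbb{R}^n\to\mathbb{R}^{n_i\times r_i}$ are Lipschitz continuous. Inputs satisfy $u_i\in\mathcal{U}_i=\prod_{j=1}^{r_i}[\underline u_{i,j},\overline u_{i,j}]$ with $\underline u_{i,j}<\overline u_{i,j}$. Inputs are measurable functions of time and trajectories are absolutely continuous solutions of the ODE. The nominal control policy of $S_i$ is a map $\hat u_i=\mu_i:\mathbb{R}^n\to\mathcal{U}_i$. Safety: $h:\mathbb{R}^n\to\mathbb{R}$ is continuously differentiable; $\frac{\partial h}{\partial x_i}$ is the row vector of partial derivatives with respect to the components of $x_i$; $\mathcal{C}=\{x:h(x)\ge 0\}$. The system is safe at time $t$ if $x(t)\in\mathcal{C}$. Nominal-policy assumption: with $\alpha$ an extended class-$\mathcal{K}$ function (continuous, strictly increasing, $\alpha(0)=0$) and a constant $\tau>0$, $$\sum_{i=1}^N \frac{\partial h}{\partial x_i}\big(f_i(x)+g_i(x)\hat u_i(x)\big)\ge -\alpha(h(x)-c)\quad\forall x\in\mathcal{C}_c,$$ $$\sum_{i=1}^N \frac{\partial h}{\partial x_i}\big(f_i(x)+g_i(x)\hat u_i(x)\big)\ge \frac{c}{\tau}\quad\forall x\in\mathcal{C}\setminus\mathcal{C}_c.$$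 Architectures and attacks: there is a finite set $\mathcal{A}=\{A_1,\dots,A_J\}$ of resilient architectures, each with a guaranteed recovery time $t(A_j)\ge 0$, and an assignment map $M:\mathcal{S}\to\mathcal{A}$. In an attack cycle $[t_0,t_f]$, each subsystem $S_i$ may be compromised at most once, on a time interval contained in $[t_0,t_f]$ whose length is at most $t(M(S_i))$; these intervals may have arbitrary order and overlap. While $S_i$ is compromised, $u_i(t)$ is an arbitrary corrupted input in $\mathcal{U}_i$; whenever $S_i$ is not compromised, $u_i(t)=\hat u_i(x(t))$. By time $t_f$ all compromised subsystems have recovered. *)

(* Defs.v *)
From HB Require Import structures.
From mathcomp Require Import all_boot all_order all_algebra.
From mathcomp Require Import all_classical all_reals all_analysis.
Set Implicit Arguments.
Unset Strict Implicit.
Unset Printing Implicit Defensive.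
Import Order.TTheory GRing.Theory Num.Theory.
Import numFieldNormedType.Exports.
Local Open Scope classical_set_scope.
Local Open Scope ring_scope.

Definition extended_class_K (R : realType) (alpha : R -> R) : Prop :=
  [/\ continuous alpha, {homo alpha : a b / a < b} & alpha 0 = 0].

Definition gradient (R : realType) (n : nat) (h : 'cV[R]_n -> R)
    (x : 'cV[R]_n) : 'rV[R]_n :=
  \row_k 'D_(delta_mx k 0) h x.

Definition continuously_differentiable (R : realType) (n : nat)
    (h : 'cV[R]_n -> R) : Prop :=
  (forall x, differentiable h x) /\ continuous (gradient h).

Definition superlevel (R : realType) (n : nat) (h : 'cV[R]_n -> R) (c : R) :
    set 'cV[R]_n :=
  [set x | c <= h x].

Definition box (R : realType) (r : nat) (lo hi : 'cV[R]_r) : set 'cV[R]_r :=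
  [set u | forall j, lo j 0 <= u j 0 <= hi j 0].

(* Intervals may share endpoints: only their interiors have to be disjoint. *)
Definition absolutely_continuous (R : realType) (V : normedModType R)
    (a b : R) (y : R -> V) : Prop :=
  forall e : R, 0 < e -> exists2 d : R, 0 < d &
    forall (m : nat) (l r : 'I_m -> R),
      (forall k, [/\ a <= l k, l k <= r k & r k <= b]) ->
      trivIset setT (fun k => `]l k, r k[%classic) ->
      \sum_k (r k - l k) < d ->
      \sum_k `|y (r k) - y (l k)| < e.

Section Interconnection.
Context (R : realType) (N : nat) (n_ r_ : 'I_N -> nat).

(* The joint state stacks the N subsystem states; submxcol x i is x_i. *)
Definition state := 'cV[R]_(\sum_i n_ i).

Definition partial (h : state -> R) (i : 'I_N) (x : state) : 'rV[R]_(n_ i) :=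
  submxrow (gradient h x) i.

Definition nominal_rate (h : state -> R) (f : forall i, state -> 'cV[R]_(n_ i))
    (g : forall i, state -> 'M[R]_(n_ i, r_ i))
    (mu : forall i, state -> 'cV[R]_(r_ i)) (x : state) : R :=
  \sum_i (partial h i x *m (f i x + g i x *m mu i x)) 0 0.

Definition nominal_policy_assumption (h : state -> R)
    (f : forall i, state -> 'cV[R]_(n_ i))
    (g : forall i, state -> 'M[R]_(n_ i, r_ i))
    (mu : forall i, state -> 'cV[R]_(r_ i)) (alpha : R -> R) (c tau : R) : Prop :=
  (forall x, superlevel h c x ->
     nominal_rate h f g mu x >= - alpha (h x - c)) /\
  (forall x, (superlevel h 0 `\` superlevel h c) x ->
     nominal_rate h f g mu x >= c / tau).

(* K i is the set of times at which subsystem i is compromised; the empty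
   interval means that it is never compromised. The values of x and u outside
   [t0, tf] are irrelevant. *)
Record attack_scenario (f : forall i, state -> 'cV[R]_(n_ i))
    (g : forall i, state -> 'M[R]_(n_ i, r_ i))
    (U : forall i, set 'cV[R]_(r_ i))
    (mu : forall i, state -> 'cV[R]_(r_ i))
    (recovery : 'I_N -> R) (t0 tf : R)
    (K : 'I_N -> interval R) (u : forall i, R -> 'cV[R]_(r_ i))
    (x : R -> state) : Prop := {
  compromise_in_cycle : forall i, [set` K i] `<=` `[t0, tf]%classic ;
  compromise_length : forall i,
    (lebesgue_measure [set` K i] <= (recovery i)%:E)%E ;
  input_measurable : forall i j,
    measurable_fun `[t0, tf]%classic (fun t => u i t j 0) ;
  input_admissible : forall i t, t \in `[t0, tf] -> U i (u i t) ;
  input_nominal : forall i t, t \in `[t0, tf] -> t \notin K i ->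
    u i t = mu i (x t) ;
  state_abs_cont : absolutely_continuous t0 tf x ;
  state_dynamics : {ae lebesgue_measure, forall t : R, t \in `]t0, tf[ ->
    forall i, is_derive t 1 (fun s => submxcol (x s) i)
                (f i (x t) + g i (x t) *m u i t)}
}.

End Interconnection.

(* Main.v *)
Require Import Defs.
From HB Require Import structures.
From mathcomp Require Import all_boot all_order all_algebra.
From mathcomp Require Import all_classical all_reals all_analysis.
From mathcomp Require Import ring lra.
Set Implicit Arguments.
Unset Strict Implicit.
Unset Printing Implicit Defensive.
Import Order.TTheory GRing.Theory Num.Theory.
Import numFieldNormedType.Exports.
Local Open Scope classical_set_scope.
Local Open Scope ring_scope.

(** Whenever h lies in ]0, c[, d/dt h(x(t)) is at least c/tau plus the sum of the
    rho_i over the subsystems compromised at time t. If h became negative, take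
    the last time s with h >= c and the first time e > s with h <= 0: between
    them the decrease of h is less than -sum_i rho_i t(M(S_i)) <= c, which is
    absurd. The derivative only exists almost everywhere, so this integration
    uses the absolute continuity of x: by Cousin's lemma [s, e] is cut into
    intervals that either satisfy the derivative bound or lie in an open set
    of small measure covering the exceptional null set. *)

(** * Tagged partitions and open covers of null sets *)

(** Let [S] be the set of points that a chain from [a] can reach. Near [sup S] the local hypothesis
    provides one more interval straddling [sup S], so a chain passes the supremum unless it is
    [b]. *)
Lemma cousin_partition (R : realType) (P : R -> R -> Prop) (a b : R) :
    a <= b ->
    (forall t, a <= t <= b -> \forall l \near t & r \near t,
       a <= l <= t -> t <= r <= b -> P l r) ->
  exists m (p : nat -> R), [/\ p 0 = a, p m = b &
    forall k, (k < m)%N -> p k <= p k.+1 /\ P (p k) (p k.+1)].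
Proof.
move=> ab locP.
pose Q s := exists m (p : nat -> R), [/\ p 0 = a, p m = s &
  forall k, (k < m)%N -> p k <= p k.+1 /\ P (p k) (p k.+1)].
pose S := [set s | a <= s <= b /\ Q s].
have Sa : S a by split; [rewrite lexx|exists 0%N, (fun=> a); split].
have ubS : ubound S b by move=> s [/andP[]].
have supS : has_sup S by split; [exists a|exists b].
have a_sup : a <= sup S by apply: ub_le_sup => //; exists b.
have sup_b : sup S <= b by apply: ge_sup => //; exists a.
have [d d0 Pd] : exists2 d, 0 < d & forall l r, `|sup S - l| < d ->
    `|sup S - r| < d -> a <= l <= sup S -> sup S <= r <= b -> P l r.
  have /locP[[A B] /= [/nbhs_ballP[d1 /= d1_gt0 dA]
    /nbhs_ballP[d2 /= d2_gt0 dB]] AB] : a <= sup S <= b by rewrite a_sup.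
  exists (Num.min d1 d2) => [|l r]; first by rewrite lt_min d1_gt0.
  rewrite !lt_min => /andP[ld _] /andP[_ rd].
  by apply: (AB (l, r)); split; [exact: dA|exact: dB].
have [s [/andP[as_ sb] [m [p [p0 pm pP]]]] s_sup] := sup_adherent d0 supS.
have s_le : s <= sup S.
  by apply: ub_le_sup; [exists b|split; [rewrite as_|exists m, p]].
pose s' := Num.min b (sup S + d / 2).
have sup_s' : sup S <= s' by rewrite /s' le_min sup_b; lra.
have s'_b : s' <= b by rewrite /s' ge_min lexx.
have s'_d : s' <= sup S + d / 2 by rewrite /s' ge_min lexx orbT.
have Qs' : Q s'.
  exists m.+1, (fun k => if (k <= m)%N then p k else s'); split => //.
    by rewrite ltnn.
  move=> k; rewrite ltnS => km; rewrite km.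
  case: ifPn => [/pP//|]; rewrite -leqNgt => mk.
  have -> : k = m by apply/eqP; rewrite eqn_leq km.
  rewrite pm; split; first exact: le_trans sup_s'.
  apply: Pd; [| | |by rewrite sup_s'].
  - by rewrite ger0_norm; lra.
  - by rewrite ler0_norm; lra.
  - by rewrite as_.
have : s' <= sup S.
  by apply: ub_le_sup; [exists b|split => //; rewrite (le_trans a_sup)].
move=> s'_sup; suff <- : s' = b by [].
apply/eqP; rewrite eq_le s'_b /= leNgt; apply/negP => s'b.
move: s'_sup; rewrite /s'; move: s'b; rewrite /s' minElt.
by case: ifP => _; lra.
Qed.

Lemma sum_itv_length_le (R : realType) (O : set R) (m : nat) (l r : 'I_m -> R) :
    measurable O -> (forall k, l k <= r k) ->
    trivIset setT (fun k => `]l k, r k[%classic) ->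
    (forall k, `]l k, r k[ `<=` O) ->
  ((\sum_k (r k - l k))%:E <= lebesgue_measure O)%E.
Proof.
move=> mO lr lr_disj lr_O.
have -> : ((\sum_k (r k - l k))%:E =
    \sum_k lebesgue_measure `]l k, r k[%classic)%E.
  rewrite -sumEFin; apply: eq_bigr => k _.
  rewrite lebesgue_measure_itv /= lte_fin; case: ltP => // rl.
  by congr EFin; apply/eqP; rewrite subr_eq0 eq_le rl lr.
rewrite -measure_bigsetU_ord //.
apply: le_measure; rewrite ?inE //.
  by apply: bigsetU_measurable.
by elim/big_ind: _ => // A B AO BO; rewrite subUset.
Qed.

Lemma negligible_open_cover (R : realType) (A : set R) (e : R) :
    lebesgue_measure.-negligible A -> 0 < e ->
  exists U : set R, [/\ open U, A `<=` U & (lebesgue_measure U < e%:E)%E].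
Proof.
move=> [B [mB B0 AB]] e0.
have B_le0 : (lebesgue_measure B <= 0)%E by rewrite B0.
(* Regularity bounds the measure of [U] minus [B] only; adding back the null set [B] costs
   nothing. *)
have [|U [oU BU UB]] := lebesgue_regularity_outer mB _ e0.
  exact: le_lt_trans B_le0 (ltry 0).
exists U; split; [by []|exact: subset_trans BU|].
rewrite -(setDUK BU); apply: le_lt_trans UB.
apply: le_trans (measureU2 _ _ _) _ => //.
  by apply: measurableD => //; exact: measurable_realfun.open_measurable.
by rewrite -[leRHS]add0e; exact: leeD.
Qed.

(** * Integration of an almost-everywhere slope bound *)

(** Absolute continuity is assumed of [x], not of [z]: on the few intervals without a slope bound,
    the decrease of [z] is paid for by the variation of [x] and the length. *)
Lemma le_of_ae_lower_slope (R : realType) (V : normedModType R) (a b L : R)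
    (x : R -> V) (z : R -> R) :
    a <= b -> 0 <= L -> absolutely_continuous a b x ->
    (forall t, a <= t <= b -> \forall l \near t & r \near t,
       a <= l <= t -> t <= r <= b ->
       z l - z r <= L * (`|x r - x l| + (r - l))) ->
    {ae lebesgue_measure, forall t, a < t < b -> forall e : R, 0 < e ->
       \forall l \near t & r \near t,
       a <= l <= t -> t <= r <= b -> z l - z r <= e * (r - l)} ->
  z a <= z b.
Proof.
move=> ab L0 xAC z_dom z_ae.
suff bound (e : R) : 0 < e -> z a - z b <= e * (b - a) + L * (e + e).
  rewrite -subr_le0; apply/ler_addgt0Pr => e e0; rewrite add0r.
  (* The bound is linear in its parameter, with coefficient [(b - a) + 2 * L]; the extra 1 makes the
     divisor positive. *)
  have k0 : 0 < (b - a) + 2 * L + 1 by lra.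
  have := bound (e / ((b - a) + 2 * L + 1)) (divr_gt0 e0 k0).
  move=> /le_trans; apply.
  set q := e / _; have -> : e = q * ((b - a) + 2 * L + 1).
    by rewrite /q divfK ?gt_eqF.
  have : 0 < q by rewrite divr_gt0.
  lra.
move=> e0; have [d0 d0_gt0 xd] := xAC _ e0.
(* Total length below [d] makes both the variation of [x] and the length itself smaller than [e]. *)
pose d := Num.min d0 e.
have d_gt0 : 0 < d by rewrite lt_min d0_gt0.
have [Z [mZ Z0 subZ]] := z_ae.
(* The endpoints count as bad because the slope hypothesis speaks of interior times only. *)
pose bad := Z `|` ([set a] `|` [set b]).
have bad_null : lebesgue_measure.-negligible bad.
  apply: negligibleU; first by exists Z; split.
  have point_null (s : R) : lebesgue_measure.-negligible [set s].
    by exists [set s]; split; [|exact: lebesgue_measure_set1|].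
  exact: negligibleU.
have [U [oU badU Ud]] := negligible_open_cover bad_null d_gt0.
pose good l r := z l - z r <= e * (r - l).
(* A tag outside [bad] yields the first alternative, a tag in [bad] the second. *)
pose P l r := good l r \/ `]l, r[%classic `<=` U /\
  z l - z r <= L * (`|x r - x l| + (r - l)).
have p_mono (p : nat -> R) m : (forall k, (k < m)%N -> p k <= p k.+1) ->
    forall i j, (i <= j <= m)%N -> p i <= p j.
  move=> pS i; elim=> [|j IH]; first by rewrite leqn0 andbC => /andP[_ /eqP ->].
  move=> /andP[]; rewrite leq_eqVlt => /predU1P[-> //|].
  rewrite ltnS => ij jm; apply: le_trans (pS _ jm).
  by apply: IH; rewrite ij ltnW.
have [t tab|m [p [p0 pm pP]]] := @cousin_partition R P a b ab.
  have [tbad|tgood] := pselect (bad t).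
    have [d1 /= d1_gt0 tU] : exists2 d1, 0 < d1 & ball t d1 `<=` U.
      exact/nbhs_ballP/open_nbhs_nbhs/(conj oU (badU _ tbad)).
    have near_t : \forall l \near t & r \near t, `|t - l| < d1 /\ `|t - r| < d1.
      by exists (ball t d1, ball t d1); [split; exact: nbhsx_ballx|case].
    apply: filterS2 (z_dom t tab) near_t => -[l r] /= dom_lr [lt1 rt1] al rb.
    right; split; last exact: dom_lr.
    move=> s /= /[!in_itv]/= /andP[ls sr]; apply: tU; rewrite /ball/=.
    by move: lt1 rt1; rewrite !ltr_norml; lra.
  have t_in : a < t < b.
    have [at_ tb] := andP tab; rewrite !lt_neqAle at_ tb !andbT.
    by apply/andP; split; apply/eqP => tE; apply: tgood; right;
      [left|right].
  have slope_t : a < t < b -> forall e : R, 0 < e ->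
      \forall l \near t & r \near t,
      a <= l <= t -> t <= r <= b -> z l - z r <= e * (r - l).
    by apply: contrapT => tZ; apply: tgood; left; exact: subZ.
  by apply: filterS (slope_t t_in _ e0) => -[l r] /= H al rb; left; exact: H.
have pS k : (k < m)%N -> p k <= p k.+1 by move=> /pP[].
(* Good intervals are collapsed to a point, so that only the bad ones count. *)
pose r k := if `[< good (p k) (p k.+1) >] then p k else p k.+1.
have pr (k : 'I_m) : p k <= r k by rewrite /r; case: ifP => _ //; exact: pS.
have rp (k : 'I_m) : r k <= p k.+1 by rewrite /r; case: ifP => _ //; exact: pS.
have p_in k : (k <= m)%N -> a <= p k <= b.
  by move=> km; rewrite -p0 -pm !(p_mono p m) ?leq0n ?km ?leqnn.
have disj : trivIset setT (fun k : 'I_m => `]p k, r k[%classic).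
  move=> i j _ _ [t []] /= /[!in_itv] /= /andP[it ti] /andP[jt tj].
  have [ij|ji|] := ltngtP i j; last exact: val_inj.
    have : p i.+1 <= p j by rewrite (p_mono p m) // ij ltnW.
    by move: (rp i) => {ij} ? ?; exfalso; lra.
  have : p j.+1 <= p i by rewrite (p_mono p m) // ji ltnW.
  by move: (rp j) => {ji} ? ?; exfalso; lra.
have rU (k : 'I_m) : `]p k, r k[ `<=` U.
  rewrite /r; case: asboolP => [_|kbad].
    by rewrite set_itvoo0 //; exact: sub0set.
  by have [_ [//|[]]] := pP k (ltn_ord k).
have len_d : \sum_(k < m) (r k - p k) < d.
  rewrite -lte_fin; apply: le_lt_trans Ud.
  by apply: sum_itv_length_le => //; exact: measurable_realfun.open_measurable.
have var_e : \sum_(k < m) `|x (r k) - x (p k)| < e.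
  apply: (xd m (fun k => p k) (fun k => r k)) => //.
    move=> k; split => //; first by have /andP[] := p_in k (ltnW (ltn_ord k)).
    by rewrite (le_trans (rp k)) //; have /andP[] := p_in k.+1 (ltn_ord k).
  by rewrite (lt_le_trans len_d) // ge_min lexx.
have len_e : \sum_(k < m) (r k - p k) < e.
  by rewrite (lt_le_trans len_d) // ge_min lexx orbT.
have -> : z a - z b = \sum_(k < m) (z (p k) - z (p k.+1)).
  rewrite -[LHS]opprB -pm -p0 -(telescope_sumr (z \o p)) //.
  by rewrite big_mkord -sumrN; apply: eq_bigr => k _; rewrite opprB.
have -> : b - a = \sum_(k < m) (p k.+1 - p k).
  by rewrite -pm -p0 -(telescope_sumr p) // big_mkord.
apply: (@le_trans _ _ (\sum_(k < m) (e * (p k.+1 - p k) +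
    L * (`|x (r k) - x (p k)| + (r k - p k))))).
  apply: ler_sum => k _; rewrite /r; case: asboolP => [kgood|kbad].
    by rewrite !subrr normr0 addr0 mulr0 addr0.
  have [kk [//|[_ /le_trans]]] := pP k (ltn_ord k); apply.
  by rewrite lerDr mulr_ge0 ?subr_ge0 // ltW.
rewrite big_split /= -!mulr_sumr lerD2l ler_wpM2l //.
by rewrite big_split /= lerD // ltW.
Qed.

(** * The time spent compromised *)

Lemma lebesgue_ae_filter (R : realType) :
  Filter (almost_everywhere (@lebesgue_measure R)).
Proof. exact: ae_filter_ringOfSetsType. Qed.

(* Up to an additive constant, phi t is the time spent in K before t. *)
Lemma interval_clock (R : realType) (K : interval R) (a b T : R) :
    [set` K] `<=` `[a, b] -> (lebesgue_measure [set` K] <= T%:E)%E ->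
  exists phi : R -> R, [/\ forall l r, l <= r -> 0 <= phi r - phi l,
    forall l r, l <= r -> phi r - phi l <= r - l,
    forall l r, phi r - phi l <= T &
    {ae lebesgue_measure, forall t, t \in K ->
       \forall l \near t & r \near t, l <= t -> t <= r ->
       phi r - phi l = r - l}].
Proof.
move=> Kab KT.
(* An empty interval has no meaningful endpoints; its clock stands still, and the length bound gives
   [0 <= T]. *)
have [K0|/set0P K_neq0] := eqVneq [set` K] set0.
  exists (fun=> 0); split=> [l r _|l r lr|l r|]; rewrite ?subrr //.
  - by rewrite subr_ge0.
  - by rewrite -lee_fin (le_trans _ KT).
  - apply/nearW => t tK; suff : [set` K] t by rewrite K0.
    exact: tK.
have infK : has_inf [set` K].
  by split=> //; exists a => t /Kab/=; rewrite in_itv => /andP[].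
have supK : has_sup [set` K].
  by split=> //; exists b => t /Kab/=; rewrite in_itv => /andP[].
set p := inf [set` K]; set q := sup [set` K].
have K_pq t : t \in K -> p <= t <= q.
  by move=> tK; rewrite ge_inf ?ub_le_sup //; [case: supK|case: infK].
have pq : p <= q.
  by have [t /K_pq/andP[pt tq]] := K_neq0; exact: le_trans tq.
have pqK : `]p, q[ `<=` [set` K].
  move=> t /=; rewrite in_itv /= => /andP[pt tq].
  have [s1 /= s1K s1t] := inf_lt K_neq0 pt.
  have [s2 /= s2K s2t] := sup_gt K_neq0 tq.
  apply: (@interval_is_interval _ K s1 s2) => //.
  by rewrite !ltW.
have pqT : q - p <= T.
  rewrite -lee_fin; apply: le_trans KT.
  have : (lebesgue_measure `]p, q[%classic <= lebesgue_measure [set` K])%E.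
    by apply: le_measure => //; rewrite inE; exact: measurable_itv.
  apply: le_trans; rewrite lebesgue_measure_itv /= lte_fin; case: ltP => // qp.
  by rewrite lee_fin subr_le0.
(* The clock is the projection onto the closure of [K]: slope one inside, constant outside. *)
move=> {KT}; exists (fun t => Num.min (Num.max t p) q); split.
- by move=> l r lr; rewrite !minElt !maxElt;
  do ?[case: (ltP _ p) => ?]; do ?[case: (ltP _ q) => ?]; lra.
- by move=> l r lr; rewrite !minElt !maxElt;
  do ?[case: (ltP _ p) => ?]; do ?[case: (ltP _ q) => ?]; lra.
- by move=> l r; rewrite !minElt !maxElt;
  do ?[case: (ltP _ p) => ?]; do ?[case: (ltP _ q) => ?]; lra.
(* The projection has kinks at [p] and [q], which may belong to [K]; hence the last clause holds
   only almost everywhere. *)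
have ae_neq (s : R) : {ae lebesgue_measure, forall t, t != s}.
  exists [set s]; split; [exact: measurable_set1|exact: lebesgue_measure_set1|].
  by move=> t /= /negP; rewrite negbK => /eqP.
have ae_filter := lebesgue_ae_filter R.
apply: filterS2 (ae_neq p) (ae_neq q) => t tp tq /K_pq /andP[pt tq'].
have {}pt : p < t by rewrite lt_neqAle eq_sym tp.
have {}tq : t < q by rewrite lt_neqAle tq.
exists ([set s | p < s], [set s | s < q]).
  by split; [exact: lt_nbhsr|exact: lt_nbhsl].
move=> [l r] /= [pl rq] lt tr.
by rewrite !minElt !maxElt;
  do ?[case: (ltP _ p) => ?]; do ?[case: (ltP _ q) => ?]; lra.
Qed.

(** * Differential calculus along a path *)

(** Straddle lemma: the first-order errors at [l] and [r] are at most [e * (t - l)] and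
    [e * (r - t)], which add up to [e * (r - l)] since [t] lies between them. *)
Lemma is_derive_lower_slope (R : realType) (y : R -> R) (t d : R) :
    is_derive t 1 y d -> forall e : R, 0 < e ->
  \forall l \near t & r \near t, l <= t -> t <= r ->
    (d - e) * (r - l) <= y r - y l.
Proof.
move=> [y_derivable yd] e e0.
have [c /= c0 slope] : \forall s \near t, `|y s - y t - d * (s - t)| <= e * `|s - t|.
  move: y_derivable => /cvg_ex[/= d' yd'].
  have d'E : d' = d by rewrite -yd; apply/esym/cvg_lim.
  move: yd'; rewrite {}d'E => /cvgrPdist_le /(_ e e0).
  move=> /nbhs_ballP[c /= c0 cP]; apply/nbhs_ballP; exists c => //= s ts.
  have [->|st] := eqVneq s t; first by rewrite !subrr mulr0 subrr normr0 mulr0.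
  have st0 : s - t != 0 by rewrite subr_eq0.
  have := cP (s - t); rewrite /ball/= sub0r normrN distrC => /(_ ts st0).
  rewrite [_%:A]mulr1 subrK => dy.
  have -> : y s - y t - d * (s - t) =
      - ((d - (s - t)^-1 *: (y s - y t)) * (s - t)).
    by rewrite mulrBl -[_ *: _]mulrC mulfVK // opprB.
  by rewrite normrN normrM (distrC t) ler_wpM2r.
exists (ball t c, ball t c); first by split; exact: nbhsx_ballx.
move=> [l r] /= [/slope dyl /slope dyr] lt tr; move: dyl dyr.
rewrite (ger0_norm (_ : 0 <= r - t)) ?subr_ge0 //.
rewrite (ler0_norm (_ : l - t <= 0)) ?subr_le0 // !ler_norml.
lra.
Qed.

Lemma mx_entry_le_norm (R : realType) m n (A : 'M[R]_(m, n)) i j :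
  `|A i j| <= `|A|.
Proof.
rewrite [leRHS]/Num.Def.normr /= mx_normrE.
exact: (le_bigmax _ (fun ij => `|A ij.1 ij.2|) (i, j)).
Qed.

(** The matrix norm is the maximum norm, hence the factor [n]. *)
Lemma norm_mulmx_row_col (R : realType) n (A : 'rV[R]_n) (v : 'cV[R]_n) :
  `|(A *m v) 0 0| <= n%:R * `|A| * `|v|.
Proof.
rewrite mxE (le_trans (ler_norm_sum _ _ _)) //.
apply: (@le_trans _ _ (\sum_(k < n) `|A| * `|v|)).
  by apply: ler_sum => k _; rewrite normrM ler_pM // mx_entry_le_norm.
by rewrite sumr_const card_ord -mulrA mulr_natl.
Qed.

Lemma derive_gradient (R : realType) n (h : 'cV[R]_n -> R) (y v : 'cV[R]_n) :
  differentiable h y -> 'D_v h y = (gradient h y *m v) 0 0.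
Proof.
move=> hy; rewrite mxE deriveE //.
rewrite [in LHS](matrix_sum_delta v) linear_sum.
apply: eq_bigr => k _; rewrite big_ord1 linearZ /= mxE deriveE //.
by rewrite [RHS]mulrC.
Qed.

Lemma is_derive_comp_gradient (R : realType) n (h : 'cV[R]_n -> R)
    (x : R -> 'cV[R]_n) (t : R) (v : 'cV[R]_n) :
    differentiable h (x t) -> is_derive t 1 x v ->
  is_derive t 1 (h \o x) ((gradient h (x t) *m v) 0 0).
Proof.
move=> hx [x_derivable <-].
have xt : differentiable x t by apply/derivable1_diffP.
have hxt : differentiable (h \o x) t by exact: differentiable_comp.
split; first exact/derivable1_diffP.
rewrite deriveE // diff_comp //= -deriveE // -deriveE //.
exact: derive_gradient.
Qed.

(** Mean value theorem on the segment from [w] to [v], inside a ball where the gradient stays below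
    [M] in norm. *)
Lemma C1_locally_lipschitz (R : realType) n (h : 'cV[R]_n -> R)
    (x0 : 'cV[R]_n) (M : R) :
    continuously_differentiable h -> `|gradient h x0| < M ->
  \forall v \near x0 & w \near x0, `|h v - h w| <= n%:R * M * `|v - w|.
Proof.
move=> [h_diff h_cont] x0M.
have /nbhs_ballP[d /= d0 dM] : \forall y \near x0, `|gradient h y| < M.
  have /cvg_norm/cvgr_lt : gradient h y @[y --> x0] --> gradient h x0.
    exact: h_cont.
  exact.
exists (ball x0 d, ball x0 d); first by split; exact: nbhsx_ballx.
move=> [v w] /= [vd wd].
pose y (s : R) := w + s *: (v - w).
have y_derive (s : R) : is_derive s 1 y (v - w).
  have scale_derive : is_derive s 1 (fun s : R => s *: (v - w)) (v - w).
    have scale_diff : is_diff s (fun r : R => r *: (v - w) : 'cV[R]_n)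
        (fun r : R => r *: (v - w)).
      exact: is_diff_scalel.
    have scale_differentiable :
      differentiable (fun r : R => r *: (v - w) : 'cV[R]_n) s by [].
    split; first exact/derivable1_diffP.
    by rewrite deriveE // diff_val scale1r.
  rewrite -[X in is_derive _ _ _ X]add0r.
  exact: (is_deriveD (f := cst w)).
have hy_derive (s : R) := is_derive_comp_gradient (h_diff (y s)) (y_derive s).
have hy_cont : {within `[0, 1], continuous (h \o y)}.
  apply: derivable_within_continuous => s _.
  by have [] := hy_derive s.
have [s s01 hs] := MVT_segment ler01 (fun s _ => hy_derive s) hy_cont.
move: hs; rewrite /= /y scale1r scale0r addr0 subrKC subr0 mulr1 => ->.
rewrite (le_trans (norm_mulmx_row_col _ _)) // ler_wpM2r // ler_wpM2l //.
apply/ltW/dM; rewrite -ball_normE /=.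
move: vd wd s01; rewrite -ball_normE /= in_itv /= => vd wd /andP[s0 s1].
(* Balls are convex. The case [s = 0] is separate because strictness comes from the term weighted by
   [s]. *)
have -> : x0 - (w + s *: (v - w)) = s *: (x0 - v) + (1 - s) *: (x0 - w).
  by apply/matrixP => i j; rewrite !mxE; ring.
rewrite (le_lt_trans (ler_normD _ _)) // !normrZ ger0_norm //.
rewrite ger0_norm ?subr_ge0 //.
have [->|s_neq0] := eqVneq s 0; first by rewrite mul0r add0r subr0 mul1r.
have : s * `|x0 - v| < s * d by rewrite ltr_pM2l // lt_neqAle eq_sym s_neq0.
have : (1 - s) * `|x0 - w| <= (1 - s) * d.
  by rewrite ler_wpM2l ?subr_ge0 // ltW.
lra.
Qed.

(** The dynamics is given block by block, whereas the chain rule needs the joint state. Derivatives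
    are compared entrywise; [tagnat.sig1] and [tagnat.sig2] find the block of an entry and its place
    there. *)
Lemma is_derive_submxcol (R : realType) (N : nat) (n_ : 'I_N -> nat)
    (x : R -> 'cV[R]_(\sum_i n_ i)) (t : R) (v : forall i, 'cV[R]_(n_ i)) :
    (forall i, is_derive t 1 (fun s => submxcol (x s) i) (v i)) ->
  is_derive t 1 x (\mxcol_i v i).
Proof.
move=> xv.
have entry k j : (fun s => x s k j) =
    (fun s => submxcol (x s) (tagnat.sig1 k) (tagnat.sig2 k) j).
  by apply/funext => s; rewrite mxE tagnat.sig2K.
have x_derivable : derivable x t 1.
  apply/derivable_mxP => k j; rewrite entry.
  by have [/derivable_mxP + _] := xv (tagnat.sig1 k); exact.
split=> //; rewrite derive_mx //; apply/matrixP => k j; rewrite !mxE entry.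
have [sub_derivable <-] := xv (tagnat.sig1 k).
by rewrite derive_mx // mxE.
Qed.

(** * Absolutely continuous paths and crossing times *)

Lemma absolutely_continuous_sub (R : realType) (V : normedModType R)
    (a b a' b' : R) (x : R -> V) :
    a <= a' -> b' <= b -> absolutely_continuous a b x ->
  absolutely_continuous a' b' x.
Proof.
move=> aa' b'b xAC e /xAC[d d0 xd]; exists d => // m l r lr; apply: xd => k.
by have [al lr_k rb] := lr k; split=> //; [exact: le_trans al|exact: le_trans b'b].
Qed.

(** Freezing the path outside [[a, b]] makes it continuous on the whole line. Clamping is
    1-Lipschitz, so absolute continuity applied to a single interval suffices. *)
Lemma absolutely_continuous_clamp (R : realType) (V : normedModType R)
    (a b : R) (x : R -> V) :
    a <= b -> absolutely_continuous a b x ->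
  continuous (fun t => x (Num.min (Num.max t a) b)).
Proof.
move=> ab xAC t; apply/cvgrPdist_lt => e e0; have [d d0 xd] := xAC _ e0.
pose p s := Num.min (Num.max s a) b.
have p_in s : a <= p s <= b.
  by rewrite /p le_min le_max ge_min !lexx ab !orbT.
have p_lip l r : l <= r -> 0 <= p r - p l <= r - l.
  move=> lr; rewrite /p !minElt !maxElt.
  by do ?[case: (ltP _ a) => ?]; do ?[case: (ltP _ b) => ?]; lra.
have close l r : l <= r -> r - l < d -> `|x (p r) - x (p l)| < e.
  move=> lr rl; have /andP[p0 pd] := p_lip _ _ lr.
  have := xd 1 (fun=> p l) (fun=> p r); rewrite !big_ord1; apply.
  - move=> _; have /andP[? _] := p_in l; have /andP[_ ?] := p_in r.
    by split=> //; rewrite -subr_ge0.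
  - by move=> i j _ _ _; rewrite !ord1.
  - exact: le_lt_trans rl.
near=> s; have st : `|t - s| < d by near: s; exact: cvgr_dist_lt.
have [ts|/ltW ts] := leP t s.
  by rewrite distrC; apply: close => //; move: st; rewrite ltr_norml; lra.
by apply: close => //; move: st; rewrite ltr_norml; lra.
Unshelve. all: by end_near.
Qed.

(** The times in question form a nonempty closed bounded set, which contains its supremum. *)
Lemma last_time_ge (R : realType) (y : R -> R) (a b c : R) :
    continuous y -> a <= b -> c <= y a ->
  exists s, [/\ a <= s, s <= b, c <= y s & forall t, s < t -> t <= b -> y t < c].
Proof.
move=> y_cont ab ya; pose S := `[a, b] `&` [set t | c <= y t].
have clS : closed S.
  apply: closedI; first exact: itv_closed.
  by apply: (@preimage_closed _ _ y [set t | c <= t]) => //; exact: closed_ge.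
have Sa : S a by split=> //=; rewrite in_itv /= lexx.
have S_le_b : ubound S b by move=> t [/=]; rewrite in_itv /= => /andP[].
have supS : has_sup S by split; [exists a|exists b].
have [/=] : S (sup S) by have := closure_sup supS.1 supS.2; rewrite -(closure_id S).1.
rewrite in_itv /= => /andP[as_ sb] ys; exists (sup S); split=> // t st tb.
rewrite ltNge; apply/negP => yt; suff : t <= sup S by rewrite leNgt st.
apply: ub_le_sup; first by exists b.
by split=> //=; rewrite in_itv /= tb andbT (le_trans as_) // ltW.
Qed.

Lemma first_time_le (R : realType) (y : R -> R) (a b c : R) :
    continuous y -> a <= b -> y b <= c ->
  exists s, [/\ a <= s, s <= b, y s <= c & forall t, a <= t -> t < s -> c < y t].
Proof.
move=> y_cont ab yb.
(* Reversing both time and sign turns a first time into a last time. *)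
have [|||s [bs sa ys y_gt]] := @last_time_ge R (fun t => - y (- t)) (- b) (- a) (- c).
- move=> t; apply: continuousN.
  apply: (continuous_comp (f := -%R) (g := y)); last exact: y_cont.
  exact: oppr_continuous.
- by rewrite lerN2.
- by rewrite opprK lerN2.
exists (- s); split; [lra|lra|by rewrite -lerN2|].
move=> t at_ ts; rewrite -ltrN2 -[t]opprK; apply: y_gt; lra.
Qed.

(** * The safety function along a trajectory *)

(** Each input is split into its nominal value and a deviation, so that the nominal-policy
    assumption and the [rho i] bound the two terms separately. *)
Lemma is_derive_along_flow (R : realType) (N : nat) (n_ r_ : 'I_N -> nat)
    (f : forall i : 'I_N, state R n_ -> 'cV[R]_(n_ i))
    (g : forall i : 'I_N, state R n_ -> 'M[R]_(n_ i, r_ i))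
    (mu : forall i : 'I_N, state R n_ -> 'cV[R]_(r_ i))
    (h : state R n_ -> R) (x : R -> state R n_) (t : R)
    (v : forall i : 'I_N, 'cV[R]_(r_ i)) :
    differentiable h (x t) ->
    (forall i, is_derive t 1 (fun s => submxcol (x s) i)
                 (f i (x t) + g i (x t) *m v i)) ->
  is_derive t 1 (h \o x) (nominal_rate h f g mu (x t) +
    \sum_i (partial h i (x t) *m g i (x t) *m (v i - mu i (x t))) 0 0).
Proof.
move=> hx /is_derive_submxcol/(is_derive_comp_gradient hx).
congr is_derive; rewrite -[gradient h (x t)]submxrowK mul_mxrow_mxcol.
rewrite /nominal_rate -big_split /= summxE; apply: eq_bigr => i _.
transitivity ((partial h i (x t) *m (f i (x t) + g i (x t) *m mu i (x t) +
  g i (x t) *m (v i - mu i (x t)))) 0 0); last by rewrite mulmxDr mxE mulmxA.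
by rewrite mulmxBr addrA addrAC addrK.
Qed.

(** One [L] serves all times: by compactness the gradient norm attains its maximum along the path,
    and adding 1 makes the bound strict. *)
Lemma locally_lipschitz_along (R : realType) (n : nat) (h : 'cV[R]_n -> R)
    (x : R -> 'cV[R]_n) (a b : R) :
    continuously_differentiable h -> a <= b -> continuous x ->
  exists2 L, 0 <= L & forall t, a <= t <= b -> \forall l \near t & r \near t,
    `|h (x l) - h (x r)| <= L * `|x l - x r|.
Proof.
move=> hC1 ab x_cont.
have grad_cont : {within `[a, b], continuous (fun t => `|gradient h (x t)|)}.
  apply: continuous_subspaceT => t.
  apply: (@continuous_comp _ _ _ (gradient h \o x) (@Num.norm _ _)).
    by apply: continuous_comp; [exact: x_cont|exact: hC1.2].
  exact: norm_continuous.
have [t0 _ t0_max] := EVT_max ab grad_cont.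
set M := `|gradient h (x t0)| in t0_max.
exists (n%:R * (M + 1)) => [|t tab].
  by rewrite mulr_ge0 ?ler0n ?addr_ge0 ?normr_ge0 ?ler01.
have tM : `|gradient h (x t)| < M + 1.
  by rewrite (le_lt_trans (t0_max t _)) ?ltrDl // in_itv.
have [[A B] /= [nA nB] AB] := C1_locally_lipschitz hC1 tM.
exists (x @^-1` A, x @^-1` B); first by split; exact: x_cont.
by move=> [l r] /= [Al Br]; exact: (AB (x l, x r)).
Qed.

Theorem theorem1 (R : realType) (N : nat) (n_ r_ : 'I_N -> nat)
  (f : forall i : 'I_N, state R n_ -> 'cV[R]_(n_ i))
  (g : forall i : 'I_N, state R n_ -> 'M[R]_(n_ i, r_ i))
  (f_lip : forall i, lipschitz (f i))
  (g_lip : forall i, lipschitz (g i))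
  (u_lo u_hi : forall i : 'I_N, 'cV[R]_(r_ i))
  (u_lo_hi : forall i j, u_lo i j 0 < u_hi i j 0)
  (mu : forall i : 'I_N, state R n_ -> 'cV[R]_(r_ i))
  (mu_admissible : forall i x, box (u_lo i) (u_hi i) (mu i x))
  (h : state R n_ -> R) (h_C1 : continuously_differentiable h)
  (c tau : R) (c_gt0 : 0 < c) (tau_gt0 : 0 < tau)
  (alpha : R -> R) (alpha_K : extended_class_K alpha)
  (nominal : nominal_policy_assumption h f g mu alpha c tau)
  (A : finType) (recovery_time : A -> R)
  (recovery_time_ge0 : forall a, 0 <= recovery_time a)
  (M : 'I_N -> A)
  (rho : 'I_N -> R) (rho_lt0 : forall i, rho i < 0)
  (rho_bound : forall i x, (superlevel h 0 `\` superlevel h c) x ->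
     forall v, box (u_lo i) (u_hi i) v ->
     (partial h i x *m g i x *m (v - mu i x)) 0 0 >= rho i)
  (budget : \sum_i rho i * recovery_time (M i) + c >= 0)
  (t0 tf : R) (t0_le_tf : t0 <= tf)
  (K : 'I_N -> interval R)
  (u : forall i : 'I_N, R -> 'cV[R]_(r_ i))
  (x : R -> state R n_)
  (scenario : attack_scenario f g (fun i => box (u_lo i) (u_hi i)) mu
                (fun i => recovery_time (M i)) t0 tf K u x)
  (x_t0 : superlevel h c (x t0)) :
  forall t, t \in `[t0, tf] -> superlevel h 0 (x t).
Proof.
move=> t1 t1_in; apply: contrapT => ht1.
have {}ht1 : h (x t1) < 0 by rewrite ltNge; apply/negP.
have [K_in K_len _ u_in u_nom x_ac x_dyn] := scenario.
pose clamp s := Num.min (Num.max s t0) tf.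
have clampE s : t0 <= s <= tf -> clamp s = s.
  by move=> /andP[t0s stf]; rewrite /clamp (max_idPl t0s) (min_idPl stf).
pose X s := x (clamp s).
have X_cont : continuous X := absolutely_continuous_clamp t0_le_tf x_ac.
have XE s : t0 <= s <= tf -> X s = x s by move=> /clampE; rewrite /X => ->.
have Y_cont : continuous (h \o X).
  move=> s; apply: continuous_comp; first exact: X_cont.
  exact/differentiable_continuous/(proj1 h_C1).
have /andP[t0t1 t1tf] : t0 <= t1 <= tf by rewrite in_itv in t1_in.
(* Strictly between [s] and [e] the state lies in the safety set but outside the margin set, where
   the [rho i] and the rate [c / tau] are valid. *)
have [||s [t0s st1 hs h_lt]] := @last_time_ge _ _ t0 t1 c Y_cont.
- by [].
- by rewrite /= XE ?lexx.
have [||e [se et1 he h_gt]] := @first_time_le _ _ s t1 0 Y_cont.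
- by [].
- by rewrite /= XE ?t0t1 // ltW.
have etf : e <= tf by exact: le_trans t1tf.
have t0e : t0 <= e by exact: le_trans se.
have stf : s <= tf by exact: le_trans etf.
have in_cycle t : s <= t <= e -> t0 <= t <= tf.
  by move=> /andP[st te]; rewrite (le_trans t0s) ?(le_trans te).
have {}hs : c <= h (x s) by rewrite -XE ?t0s.
have {}he : h (x e) <= 0 by rewrite -XE ?t0e.
have [phi phiP] := choice (fun i => interval_clock
  (K_in i) (K_len i)).
have [L L0 hL] := locally_lipschitz_along h_C1 t0_le_tf X_cont.
(* z is h minus the guaranteed lower bound on its growth. *)
pose z t := h (X t) - c / tau * t - \sum_i rho i * phi i t.
have zB l r : z l - z r = h (X l) - h (X r) + c / tau * (r - l) +
    \sum_i rho i * (phi i r - phi i l).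
  under eq_bigr do rewrite mulrBr.
  by rewrite sumrB /z; ring.
have ctau : 0 < c / tau by exact: divr_gt0.
have z_le : z s <= z e.
  (* [L] accounts for [h] and [c / tau] for the linear term; the clock terms never make [z]
     decrease, since each [rho i] is negative. *)
  apply: (le_of_ae_lower_slope (x := x) (L := L + c / tau) se).
  - by rewrite addr_ge0 // ltW.
  - exact: absolutely_continuous_sub x_ac.
  - move=> t ste; apply: filterS (hL t (in_cycle t ste)) => -[l r] /= hlr.
    move=> /andP[sl lt] /andP[tr re].
    have lr : l <= r by exact: le_trans tr.
    have [l_in r_in] : t0 <= l <= tf /\ t0 <= r <= tf.
      by split; apply: in_cycle; rewrite ?sl ?re ?(le_trans lr) ?(le_trans sl).
    move: hlr; rewrite zB !XE // (distrC (x l)) => hlr.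
    have phi_le : \sum_i rho i * (phi i r - phi i l) <= 0.
      rewrite -oppr_ge0 -sumrN sumr_ge0 // => i _.
      have [/(_ _ _ lr) phi_ge0 _ _ _] := phiP i.
      by rewrite -mulNr mulr_ge0 // oppr_ge0 ltW.
    have := ler_norm (h (x l) - h (x r)).
    have : 0 <= L * (r - l) by rewrite mulr_ge0 // subr_ge0.
    have : 0 <= c / tau * `|x r - x l| by rewrite mulr_ge0 // ltW.
    lra.
  have ae_filter := lebesgue_ae_filter R.
  have phi_ae := filter_forall ae_filter (fun i => let: And4 _ _ _ H := phiP i in H).
  apply: filterS2 x_dyn phi_ae => t dyn phi_t /andP[st te] d d_gt0.
  have t_open : t0 < t < tf by rewrite (le_lt_trans t0s st) (lt_le_trans te).
  have t_in : t0 <= t <= tf by have /andP[? ?] := t_open; rewrite !ltW.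
  have safe_t : (superlevel h 0 `\` superlevel h c) (x t).
    rewrite -XE //; split.
      by apply/ltW/h_gt => //; exact: ltW.
    apply/negP; rewrite -ltNge; apply: h_lt => //.
    by rewrite ltW // (lt_le_trans te).
  have /is_derive_lower_slope /(_ _ d_gt0) slope :=
    is_derive_along_flow mu ((proj1 h_C1) (x t)) (dyn t_open).
  set rate := nominal_rate _ _ _ _ _ + _ in slope.
  (* A compromised subsystem contributes at least [rho i]; any other has its nominal input and
     contributes 0. *)
  have rate_ge : c / tau + \sum_i rho i * (t \in K i)%:R <= rate.
    apply: lerD; first exact: (proj2 nominal).
    apply: ler_sum => i _; have [tK|tK] := boolP (t \in K i).
      rewrite mulr1; apply: rho_bound => //.
      exact: u_in.
    by rewrite u_nom // subrr mulmx0 mxE mulr0.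
  (* Off [K i] monotonicity of the clock is enough: a lower bound on its increment becomes an upper
     bound once multiplied by the negative [rho i]. *)
  have phi_near : \forall p \near filter_prod (nbhs t) (nbhs t), forall i,
      p.1 <= t -> t <= p.2 ->
      phi i p.2 - phi i p.1 >= (t \in K i)%:R * (p.2 - p.1).
    apply: filter_forall => i; have [tK|tK] := boolP (t \in K i).
      apply: filterS (phi_t i tK) => -[l r] /= H lt tr.
      by rewrite mul1r H.
    apply: nearW => -[l r] /= lt tr; rewrite mul0r.
    have [/(_ l r) + _ _ _] := phiP i; apply; exact: le_trans tr.
  apply: filterS2 slope phi_near => -[l r] /= slope phi_lr.
  move=> /andP[sl lt] /andP[tr re].
  have lr : l <= r by exact: le_trans tr.
  have [l_in r_in] : t0 <= l <= tf /\ t0 <= r <= tf.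
    by split; apply: in_cycle; rewrite ?sl ?re ?(le_trans lr) ?(le_trans sl).
  rewrite zB !XE //.
  have : \sum_i rho i * (phi i r - phi i l) <=
      (\sum_i rho i * (t \in K i)%:R) * (r - l).
    rewrite mulr_suml; apply: ler_sum => i _; rewrite -mulrA.
    by rewrite ler_wnM2l ?phi_lr // ltW.
  have := slope lt tr.
  have : (c / tau + \sum_i rho i * (t \in K i)%:R) * (r - l) <= rate * (r - l).
    by rewrite ler_wpM2r // subr_ge0.
  lra.
have s_lt_e : s < e.
  rewrite lt_neqAle se andbT; apply/eqP => seE.
  by move: hs he; rewrite seE => /(lt_le_trans c_gt0) /lt_le_trans H /H; rewrite ltxx.
have : \sum_i rho i * (phi i e - phi i s) >=
    \sum_i rho i * recovery_time (M i).
  apply: ler_sum => i _; have [_ _ phi_le _] := phiP i.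
  by rewrite ler_wnM2l ?phi_le // ltW.
(* The drop of [h] from [s] to [e] is at least [c], which the budget could just match; this strictly
   positive term gives the contradiction. *)
have : 0 < c / tau * (e - s) by rewrite mulr_gt0 // subr_gt0.
move: z_le; rewrite -subr_le0 zB !XE ?t0s ?t0e //.
lra.
Qed.
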